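(* Let $\mathfrak C$ be a left cancellative small category. The canonical projection $I_l\ltimes\Omega\twoheadrightarrow I_l\,\bar\ltimes\,\Omega$ is an isomorphism (of topological groupoids) if one of the following holds: (i) $\mathfrak C$ is finitely aligned. (ii) $I_l\ltimes\Omega$ is Hausdorff.
   Context: $\mathfrak C$ denotes the set of morphisms, $\mathfrak C^0\subseteq\mathfrak C$ the identity morphisms, $\mathfrak d,\mathfrak t$ domain and target; $cd$ is defined iff $\mathfrak d(c)=\mathfrak t(d)$; left cancellative means $cx=cy\Rightarrow x=y$. $\mathfrak C$ is finitely aligned if for all $a,b\in\mathfrak C$ there is a finite $F\subseteq\mathfrak C$ with $a\mathfrak C\cap b\mathfrak C=\bigcup_{c\in F}c\mathfrak C$. Each $c\in\mathfrak C$ gives the partial bijection $\mathfrak d(c)\mathfrak C\to c\mathfrak C$, $x\mapsto cx$; $I_l$ is the smallest semigroup of partial bijections of $\mathfrak C$ containing these and closed under inverses; $\mathcal J=\{\mathrm{dom}(s):s\in I_l\}$ is its semilattice of idempotents (product = intersection). $\bar{\mathcal J}$ is the set of subsets $\varepsilon=e\setminus\bigcup_{i=1}^nf_i$ with $e,f_i\in\mathcal J$, $f_i\subseteq e$. $\widehat{\mathcal J}$ is the space of non-zero multiplicative maps $\chi:\mathcal J\to\{0,1\}$ with $\chi(\emptyset)=0$ if $\emptyset\in\mathcal J$ (pointwise convergence). $\Omega\subseteq\widehat{\mathcal J}$ consists of those $\chi$ such that whenever $e=\bigcup_{i=1}^nf_i$ ($e,f_i\in\mathcal J$) and $\chi(e)=1$,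 then $\chi(f_i)=1$ for some $i$. For $\chi\in\Omega$, $\varepsilon=e\setminus\bigcup f_i\in\bar{\mathcal J}$, put $\chi(\varepsilon)=1$ iff $\chi(e)=1$ and all $\chi(f_i)=0$, and $\chi(\varepsilon)=0$ otherwise. $s\in I_l$ acts by $\chi\mapsto s.\chi=\chi(s^{-1}\cdot s)$ from $\Omega(s^{-1}s)=\{\chi\in\Omega:\chi(s^{-1}s)=1\}$ onto $\Omega(ss^{-1})$. $I_l\ltimes\Omega$ is the quotient of $\{(s,\chi)\in I_l\times\Omega:\chi(s^{-1}s)=1\}$ by $(s,\chi)\sim(t,\psi)$ iff $\chi=\psi$ and $se=te$ for some $e\in\mathcal J$ with $\chi(e)=1$; $I_l\,\bar\ltimes\,\Omega$ is the quotient by $(s,\chi)\bar\sim(t,\psi)$ iff $\chi=\psi$ and $s\varepsilon=t\varepsilon$ for some $\varepsilon\in\bar{\mathcal J}$ with $\chi(\varepsilon)=1$ ($se$, $s\varepsilon$ denote restrictions as partial bijections). Both are groupoids with source $\chi$, range $s.\chi$, $[s,t.\chi][t,\chi]=[st,\chi]$; in both cases the topology is such that the images of $\{s\}\times\Omega(s^{-1}s)$ are open and mapped homeomorphically onto $\Omega(s^{-1}s)$ by the source map. The canonical projection sends the $\sim$-class of $(s,\chi)$ to its $\bar\sim$-class. *)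

(* Defs.v *)
From HB Require Import structures.
From mathcomp Require Import all_boot.
From mathcomp Require Import all_classical.
From mathcomp Require Import topology.

Set Implicit Arguments.
Unset Strict Implicit.
Unset Printing Implicit Defensive.

Local Open Scope classical_set_scope.
Local Open Scope quotient_scope.

Local Obligation Tactic := idtac.

(** A small category is given by its set of morphisms; identities are
    morphisms, and [dom], [tgt] take values in identities.  [comp c x] is the
    product [cx], which is meaningful only if [dom c = tgt x]: its value is
    unconstrained otherwise. *)
Record small_category := SmallCategory {
  mor :> Type;
  dom : mor -> mor;
  tgt : mor -> mor;
  comp : mor -> mor -> mor;
  dom_dom : forall c, dom (dom c) = dom c;
  tgt_dom : forall c, tgt (dom c) = dom c;
  dom_tgt : forall c, dom (tgt c) = tgt c;
  tgt_tgt : forall c, tgt (tgt c) = tgt c;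
  dom_comp : forall c x, dom c = tgt x -> dom (comp c x) = dom x;
  tgt_comp : forall c x, dom c = tgt x -> tgt (comp c x) = tgt c;
  comp_dom : forall c, comp c (dom c) = c;
  tgt_compl : forall c, comp (tgt c) c = c;
  compA : forall b c x, dom b = tgt c -> dom c = tgt x ->
    comp b (comp c x) = comp (comp b c) x }.

Record lc_category := LCCategory {
  lc_cat :> small_category;
  lc_cancel : forall c x y : lc_cat, dom c = tgt x -> dom c = tgt y ->
    comp c x = comp c y -> x = y }.

Definition rideal (C : small_category) (c : C) : set C :=
  [set y | exists2 x, dom c = tgt x & y = comp c x].

Definition finitely_aligned (C : small_category) : Prop :=
  forall a b : C, exists F : set C,
    finite_set F /\ rideal a `&` rideal b = \bigcup_(c in F) rideal c.

Record pbij (T : Type) := PBij {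
  graph :> T -> T -> Prop;
  graph_fun : forall x y z, graph x y -> graph x z -> y = z;
  graph_inj : forall x y z, graph x z -> graph y z -> x = y }.

HB.instance Definition _ (T : Type) := gen_eqMixin (pbij T).
HB.instance Definition _ (T : Type) := gen_choiceMixin (pbij T).

Lemma pbijP (T : Type) (s t : pbij T) :
  (forall x y, s x y <-> t x y) -> s = t.
Proof.
case: s t => [s s1 s2] [t t1 t2] /= st.
have e : s = t by apply/funext => x; apply/funext => y; apply/propext.
by subst t; congr PBij; exact: Prop_irrelevance.
Qed.

Section pbij_ops.
Variable T : Type.
Implicit Types (s t : pbij T) (A : set T).

Program Definition pcomp s t : pbij T :=
  @PBij T (fun x z => exists2 y, t x y & s y z) _ _.
Next Obligation.
move=> s t x y z [u tu su] [v tv sv]; rewrite (graph_fun tu tv) in su.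
exact: graph_fun su sv.
Qed.
Next Obligation.
move=> s t x y z [u tu su] [v tv sv]; rewrite (graph_inj su sv) in tu.
exact: graph_inj tu tv.
Qed.

Program Definition pinv s : pbij T := @PBij T (fun x y => s y x) _ _.
Next Obligation. by move=> s x y z; exact: graph_inj. Qed.
Next Obligation. by move=> s x y z; exact: graph_fun. Qed.

Definition pdom s : set T := [set x | exists y, s x y].

Definition ppre s A : set T := [set x | exists2 y, s x y & A y].

Program Definition prestr s A : pbij T := @PBij T (fun x y => A x /\ s x y) _ _.
Next Obligation. by move=> s A x y z [_ sxy] [_]; exact: graph_fun sxy. Qed.
Next Obligation. by move=> s A x y z [_ sxz] [_]; exact: graph_inj sxz. Qed.

Definition inverse_semigroup : set (set (pbij T)) := [set S |
  (forall s t, S s -> S t -> S (pcomp s t)) /\ (forall s, S s -> S (pinv s))].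

End pbij_ops.

Section hull.
Variable C : lc_category.
Implicit Types (s t : pbij C) (e f : set C).

Program Definition lmul (c : C) : pbij C :=
  @PBij C (fun x y => dom c = tgt x /\ y = comp c x) _ _.
Next Obligation. by move=> c x y z [_ ->] [_ ->]. Qed.
Next Obligation. by move=> c x y z [cx ->] [cy]; exact: lc_cancel. Qed.

Definition Il : set (pbij C) := smallest (@inverse_semigroup C) (range lmul).

Definition J : set (set C) := [set @pdom C s | s in Il].

Lemma Il_comp s t : Il s -> Il t -> Il (pcomp s t).
Proof.
by move=> Is It S hS; apply: hS.1.1; [exact: Is|exact: It].
Qed.

Lemma Il_inv s : Il s -> Il (pinv s).
Proof. by move=> Is S hS; apply: hS.1.2; exact: Is. Qed.

Lemma J_dom s : Il s -> J (pdom s).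
Proof. by move=> Is; exists s. Qed.

Lemma J_pre s e : Il s -> J e -> J (ppre s e).
Proof.
move=> Is [t It <-]; exists (pcomp t s); first exact: Il_comp.
apply/seteqP; split => [x [z [y sxy tyz]]|x [y sxy [z tyz]]].
  by exists y => //; exists z.
by exists z, y.
Qed.

Definition pid e : pbij C :=
  @PBij C (fun x y => e x /\ x = y)
    (fun x y z h1 h2 => etrans (esym h1.2) h2.2)
    (fun x y z h1 h2 => etrans h1.2 (esym h2.2)).

Lemma Il_pid e : J e -> Il (pid e).
Proof.
move=> [s Is <-]; suff -> : pid (pdom s) = pcomp (pinv s) s.
  by apply: Il_comp => //; exact: Il_inv.
apply: pbijP => x y; split=> [[[z sxz] <-]|[z /= sxz syz]]; first by exists z.
by split; [exists z|exact: graph_inj sxz syz].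
Qed.

Lemma JI e f : J e -> J f -> J (e `&` f).
Proof.
move=> /Il_pid Je /(J_pre Je); congr J; apply/seteqP; split=> x.
  by case=> y [] ? <-.
by case=> ex fx; exists x.
Qed.

Definition Jel e (Je : J e) : J := exist _ e (mem_set Je).

Definition Jmap := {ptws J -> bool}.

(** [chi_at chi e] says that [e] belongs to [J] and [chi e = 1]. *)
Definition chi_at (chi : Jmap) (e : set C) : Prop :=
  exists2 i : J, set_val i = e & chi i = true.

Definition Jhat : set Jmap := [set chi : Jmap |
  [/\ exists e : J, chi e = true,
      forall e f g : J, set_val g = set_val e `&` set_val f ->
        chi g = chi e && chi f
    & forall e : J, set_val e = set0 -> chi e = false]].

Definition Omega : set Jmap := [set chi : Jmap | Jhat chi /\
  forall (e : J) (n : nat) (f : 'I_n -> J),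
    set_val e = \bigcup_i set_val (f i) ->
    chi e = true -> exists i, chi (f i) = true].

(** [eps] is represented as [e \ (f_1 u ... u f_n)]; [n = 0] is allowed, so
    that [J] is contained in [Jbar]. *)
Definition Jbar_repr (eps : set C) (e : J) (n : nat) (f : 'I_n -> J) : Prop :=
  (forall i, set_val (f i) `<=` set_val e) /\
  eps = set_val e `\` \bigcup_i set_val (f i).

Definition Jbar : set (set C) :=
  [set eps | exists (e : J) (n : nat) (f : 'I_n -> J), Jbar_repr eps e f].

(** [chi_bar chi eps] says that [eps] belongs to [Jbar] and [chi eps = 1]; on
    [Omega] this does not depend on the representation of [eps], see
    [chi_barE]. *)
Definition chi_bar (chi : Jmap) (eps : set C) : Prop :=
  exists (e : J) (n : nat) (f : 'I_n -> J),
    [/\ Jbar_repr eps e f, chi e = true & forall i, chi (f i) = false].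


Lemma chi_ext (chi : Jmap) (e f : J) :
  set_val e = set_val f -> chi e = chi f.
Proof. by move=> /val_inj ->. Qed.

Definition meetJ (e f : J) : J := Jel (JI (set_valP e) (set_valP f)).

Lemma chi_meet (chi : Jmap) (e f : J) : Omega chi ->
  chi (meetJ e f) = chi e && chi f.
Proof. by move=> [[_ + _] _]; apply. Qed.

Definition catJ (n m : nat) (f : 'I_n -> J) (g : 'I_m -> J) (i : 'I_(n + m)) :=
  match fintype.split i with inl j => f j | inr j => g j end.

Lemma bigcup_catJ n m (f : 'I_n -> J) (g : 'I_m -> J) :
  \bigcup_i set_val (catJ f g i) =
  \bigcup_i set_val (f i) `|` \bigcup_i set_val (g i).
Proof.
apply/seteqP; split => x.
  by move=> [i _]; rewrite /catJ; case: fintype.split => j xj; [left|right]; exists j.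
case=> -[i _ xi].
  exists (lshift m i) => //; rewrite /catJ.
  by case: split_ordP => [j /lshift_inj<-|j /eqP] //; rewrite eq_lrshift.
exists (rshift n i) => //; rewrite /catJ.
by case: split_ordP => [j /eqP|j /rshift_inj<-] //; rewrite eq_rlshift.
Qed.

Lemma chi_bar_cover (chi : Jmap) eps (e : J) n (f : 'I_n -> J) :
  Omega chi -> chi_bar chi eps -> chi e = true ->
  set_val e `&` eps `<=` \bigcup_i set_val (f i) ->
  exists i, chi (f i) = true.
Proof.
move=> Ochi [e0 [m [g [[_ ->] che0 chg]]]] che sub.
pose k := meetJ e e0.
have chk : chi k = true by rewrite chi_meet // che che0.
have [] := Ochi.2 k _ (fun i => meetJ k (catJ f g i)) _ chk; last first.
  move=> i; rewrite chi_meet // chk /catJ /=; case: fintype.split => j // h.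
    by exists j.
  by rewrite chg in h.
have -> : \bigcup_i set_val (meetJ k (catJ f g i)) =
          set_val k `&` \bigcup_i set_val (catJ f g i).
  by rewrite setI_bigcupr.
rewrite bigcup_catJ; apply/seteqP; split => [x kx|x []//]; split => //.
case: kx => ex e0x.
by have [h|h] := pselect ((\bigcup_i set_val (g i)) x); [right|left; apply: sub].
Qed.

Lemma chi_barE (chi : Jmap) eps (e : J) n (f : 'I_n -> J) :
  Omega chi -> Jbar_repr eps e f ->
  chi_bar chi eps <-> chi e = true /\ forall i, chi (f i) = false.
Proof.
move=> Ochi ref; split=> [che|[che chf]]; last by exists e, n, f.
split.
  have [e' [m [g [re' che' _]]]] := che.
  have [|_ //] := @chi_bar_cover chi eps e' 1 (fun=> e) Ochi che che'.
  by rewrite ref.2 => x [_ [ex _]]; exists ord0.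
move=> i; apply/negbTE/negP => chf.
have [|[]//] := @chi_bar_cover chi eps (f i) 0 (fun=> e) Ochi che chf.
by rewrite ref.2 => x [fx [_ []]]; exists i.
Qed.

Lemma chi_atP (chi : Jmap) e : chi_at chi e -> chi_bar chi e.
Proof.
move=> [i <- chi1]; exists i, 0, (fun=> i); split => //; last by case.
split; first by case.
by apply/seteqP; split=> [x ix|x []//]; split => // -[[]].
Qed.

(** [act_map s chi] is [chi (s^-1 . s)]: the idempotent [s^-1 e s] is the
    identity of the set [ppre s e]. *)
Definition act_map (s : Il) (chi : Jmap) : Jmap :=
  fun e : J => chi (Jel (J_pre (set_valP s) (set_valP e))).

Definition domJ (s : Il) : J := Jel (J_dom (set_valP s)).

Lemma act_Omega (s : Il) (chi : Jmap) :
  Omega chi -> chi (domJ s) = true -> Omega (act_map s chi).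
Proof.
move=> Ochi chs; have [[_ chiI chi0] chiU] := Ochi; split; first split.
- exists (Jel (J_dom (Il_inv (set_valP s)))); rewrite -chs /act_map.
  by apply: chi_ext; apply/seteqP; split => x [y sxy]; exists y => //; exists x.
- move=> e f g efg; apply: chiI => /=; rewrite !set_valE /= -!set_valE efg.
  apply/seteqP; split => x.
    by move=> [y sxy [ey fy]]; split; exists y.
  move=> [[y sxy ey] [z sxz fz]]; exists y => //; split => //.
  by rewrite (graph_fun sxy sxz).
- move=> e e0; apply: chi0; rewrite !set_valE /= -!set_valE e0.
  by apply/seteqP; split => x // [].
- move=> e n f ef /chiU; apply; rewrite !set_valE /= -!set_valE ef.
  apply/seteqP; split => x.
    by move=> [y sxy [i _ fy]]; exists i => //; exists y.
  by move=> [i _ [y sxy fy]]; exists y => //; exists i.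
Qed.

(** The pairs [(s, chi)] in [Il * Omega] with [chi (s^-1 s) = 1], as a subspace
    of the product of the discrete space [Il] and of [Omega]. *)
Definition pregerm : set (discrete_topology Il * Omega) :=
  [set x | set_val x.2 (domJ x.1) = true].

Definition gel (x : pregerm) : Il := (set_val x).1.
Definition gchi (x : pregerm) : Omega := (set_val x).2.

Lemma gchiP (x : pregerm) : set_val (gchi x) (domJ (gel x)) = true.
Proof. exact: (set_valP x). Qed.

Definition mkpre (s : Il) (chi : Omega) (h : set_val chi (domJ s) = true) :
  pregerm := exist _ (s, chi) (mem_set h).

Definition act (x : pregerm) : Omega :=
  exist _ (act_map (gel x) (set_val (gchi x)))
    (mem_set (act_Omega (set_valP (gchi x)) (gchiP x))).

End hull.

Arguments J C : clear implicits.
Arguments Il C : clear implicits.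
Arguments Jmap C : clear implicits.
Arguments Jhat C : clear implicits.
Arguments Omega C : clear implicits.
Arguments pregerm C : clear implicits.
Arguments Jbar C : clear implicits.

(** [gmul g h] is meaningful only if [src g = rng h]. *)
Record topological_groupoid := TopologicalGroupoid {
  arrow :> topologicalType;
  unit_space : topologicalType;
  src : arrow -> unit_space;
  rng : arrow -> unit_space;
  gid : unit_space -> arrow;
  ginv : arrow -> arrow;
  gmul : arrow -> arrow -> arrow;
  src_id : forall x, src (gid x) = x;
  rng_id : forall x, rng (gid x) = x;
  src_inv : forall g, src (ginv g) = rng g;
  rng_inv : forall g, rng (ginv g) = src g;
  src_mul : forall g h, src g = rng h -> src (gmul g h) = src h;
  rng_mul : forall g h, src g = rng h -> rng (gmul g h) = rng g;
  gmulA : forall g h k, src g = rng h -> src h = rng k ->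
    gmul g (gmul h k) = gmul (gmul g h) k;
  gmul1 : forall g, gmul g (gid (src g)) = g;
  gmul1l : forall g, gmul (gid (rng g)) g = g;
  gmulV : forall g, gmul g (ginv g) = gid (rng g);
  gmulVl : forall g, gmul (ginv g) g = gid (src g);
  src_continuous : continuous src;
  rng_continuous : continuous rng;
  gid_continuous : continuous gid;
  ginv_continuous : continuous ginv;
  gmul_continuous : {within [set gh | src gh.1 = rng gh.2],
    continuous (fun gh : arrow * arrow => gmul gh.1 gh.2)} }.

Definition topological_groupoid_iso (G H : topological_groupoid) (p : G -> H) :
    Prop :=
  [/\ bijective p, continuous p, (forall U : set G, open U -> open (p @` U)),
      (forall g h : G, src (p g) = rng (p h) <-> src g = rng h)
    & (forall g h : G, src g = rng h -> p (gmul g h) = gmul (p g) (p h))].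

(** Both groupoids of germs identify [(s, chi)] and [(t, chi)] if [s] and [t]
    have the same restriction to some [A] with [P chi A], where [P chi] is
    either [{e in J | chi e = 1}] or [{eps in Jbar | chi eps = 1}].  This record
    collects the properties of [P] that make the germs a topological
    groupoid. *)
Record germ_base (C : lc_category) := GermBase {
  gb_at :> Jmap C -> set (set C);
  gb_I : forall chi A B, Omega C chi -> gb_at chi A -> gb_at chi B ->
    gb_at chi (A `&` B);
  gb_J : forall chi (e : J C), chi e = true -> gb_at chi (set_val e);
  gb_act : forall s chi A, Omega C chi -> chi (domJ s) = true ->
    gb_at (act_map s chi) A -> gb_at chi (ppre (set_val s) A);
  gb_ext : forall chi A (e f : J C), Omega C chi -> gb_at chi A ->
    set_val e `&` A `<=` set_val f -> chi e = true -> chi f = true;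
  gb_open : forall A,
    open [set chi : Omega C | gb_at (set_val chi) A] }.

Section bases.
Variable C : lc_category.

Lemma chi_at_I (chi : Jmap C) A B : Omega C chi -> chi_at chi A ->
  chi_at chi B -> chi_at chi (A `&` B).
Proof.
move=> Ochi [e <- che] [f <- chf]; exists (meetJ e f) => //.
by rewrite chi_meet // che chf.
Qed.

Lemma chi_at_J (chi : Jmap C) (e : J C) : chi e = true ->
  chi_at chi (set_val e).
Proof. by exists e. Qed.

Lemma chi_at_act (s : Il C) (chi : Jmap C) A : Omega C chi ->
  chi (domJ s) = true ->
  chi_at (act_map s chi) A -> chi_at chi (ppre (set_val s) A).
Proof. by move=> _ _ [e <- che]; eexists; last exact: che. Qed.

Lemma chi_at_ext (chi : Jmap C) A (e f : J C) : Omega C chi ->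
  chi_at chi A -> set_val e `&` A `<=` set_val f -> chi e = true ->
  chi f = true.
Proof.
move=> Ochi /chi_atP chA sub che.
have [|_ //] := @chi_bar_cover _ chi A e 1 (fun=> f) Ochi chA che.
by move=> x /sub fx; exists ord0.
Qed.

Lemma chi_bar_I (chi : Jmap C) A B : Omega C chi -> chi_bar chi A ->
  chi_bar chi B -> chi_bar chi (A `&` B).
Proof.
move=> Ochi [e [n [f [[_ ->] che chf]]]] [e' [m [g [[_ ->] che' chg]]]].
pose k := meetJ e e'; exists k, (n + m)%N, (fun i => meetJ k (catJ f g i)).
split; last 2 first.
- by rewrite chi_meet // che che'.
- by move=> i; rewrite chi_meet // /catJ; case: fintype.split => j;
    rewrite ?chf ?chg andbF.
split; first by move=> i x [].
have -> : \bigcup_i set_val (meetJ k (catJ f g i)) =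
          set_val k `&` \bigcup_i set_val (catJ f g i).
  by rewrite setI_bigcupr.
rewrite bigcup_catJ; apply/seteqP; split => x.
  by move=> [[ex fx] [e'x gx]]; split => // -[_ []].
by move=> [[ex e'x] h]; split; split => // k'; apply: h; split => //;
  [left|right].
Qed.

Lemma chi_bar_J (chi : Jmap C) (e : J C) : chi e = true ->
  chi_bar chi (set_val e).
Proof. by move=> che; apply: chi_atP; exists e. Qed.

Lemma ppreD (s : pbij C) A B : ppre s (A `\` B) = ppre s A `\` ppre s B.
Proof.
apply/seteqP; split => x.
  move=> [y sxy [Ay nBy]]; split; first by exists y.
  by move=> [z sxz]; rewrite -(graph_fun sxy sxz).
by move=> [[y sxy Ay] nB]; exists y => //; split => // By; apply: nB; exists y.
Qed.

Lemma ppre_bigcup (s : pbij C) n (f : 'I_n -> set C) :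
  ppre s (\bigcup_i f i) = \bigcup_i ppre s (f i).
Proof.
apply/seteqP; split => x.
  by move=> [y sxy [i _ fy]]; exists i => //; exists y.
by move=> [i _ [y sxy fy]]; exists y => //; exists i.
Qed.

Lemma chi_bar_act (s : Il C) (chi : Jmap C) A : Omega C chi ->
  chi (domJ s) = true ->
  chi_bar (act_map s chi) A -> chi_bar chi (ppre (set_val s) A).
Proof.
move=> Ochi chs [e [n [f [[fe ->] che chf]]]].
exists (Jel (J_pre (set_valP s) (set_valP e))), n,
  (fun i => Jel (J_pre (set_valP s) (set_valP (f i)))); split => //.
split=> [i x [y sxy fy]|]; first by exists y => //; exact: (fe i).
by rewrite ppreD ppre_bigcup.
Qed.

Lemma chi_bar_ext (chi : Jmap C) A (e f : J C) : Omega C chi ->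
  chi_bar chi A -> set_val e `&` A `<=` set_val f -> chi e = true ->
  chi f = true.
Proof.
move=> Ochi chA sub che.
have [|_ //] := @chi_bar_cover _ chi A e 1 (fun=> f) Ochi chA che.
by move=> x /sub fx; exists ord0.
Qed.

Lemma chi_continuous (e : J C) : continuous (fun chi : Omega C => set_val chi e).
Proof.
move=> chi; apply: (@continuous_comp _ _ _ set_val (fun f : Jmap C => f e)).
  exact: initial_continuous.
exact: (@proj_continuous (J C) (fun=> bool) e).
Qed.

Lemma Omega_continuous (T : topologicalType) (f : T -> Omega C) :
  (forall e : J C, continuous (fun x => set_val (f x) e)) -> continuous f.
Proof.
move=> fc; apply: continuous_comp_initial => x; apply/cvg_sup => e.
move=> A [_ [[B oB <-] Bx BA]]; apply: filterS BA _.
exact: (fc e x _ (open_nbhs_nbhs (conj oB Bx))).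
Qed.

Lemma chi_open (e : J C) b : open [set chi : Omega C | set_val chi e = b].
Proof.
rewrite [X in open X](_ : _ = (fun chi : Omega C => set_val chi e) @^-1` [set b]) //.
apply: open_comp; last exact: discrete_open.
by move=> chi _; exact: chi_continuous.
Qed.

Lemma chi_at_open A : open [set chi : Omega C | chi_at (set_val chi) A].
Proof.
have [JA|nJA] := pselect (J C A).
  rewrite [X in open X](_ : _ =
    [set chi : Omega C | set_val chi (Jel JA) = true]); first exact: chi_open.
  apply/seteqP; split => chi /=; last by exists (Jel JA).
  by move=> [e eA <-]; apply: chi_ext; rewrite eA.
rewrite [X in open X](_ : _ = set0); first exact: open0.
apply/seteqP; split => // chi [e eA _]; apply: nJA; rewrite -eA.
exact: set_valP.
Qed.

Lemma chi_bar_open A : open [set chi : Omega C | chi_bar (set_val chi) A].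
Proof.
rewrite openE => chi [e [n [f [re che chf]]]]; rewrite /interior.
have h1 : nbhs chi [set psi : Omega C | set_val psi e = true].
  exact: (open_nbhs_nbhs (conj (chi_open e true) che)).
have h2 : nbhs chi
    [set psi : Omega C | forall i, set_val psi (f i) = false].
  have h i : nbhs chi [set psi : Omega C | set_val psi (f i) = false].
    exact: (open_nbhs_nbhs (conj (chi_open (f i) false) (chf i))).
  exact: (filter_forall (nbhs_pfilter chi) h).
by apply: filterS2 h1 h2 => psi pe pf; exists e, n, f.
Qed.

Definition J_base := GermBase chi_at_I chi_at_J chi_at_act chi_at_ext chi_at_open.

Definition Jbar_base :=
  GermBase chi_bar_I chi_bar_J chi_bar_act chi_bar_ext chi_bar_open.

End bases.

Section pregerms.
Variable C : lc_category.
Implicit Types (s t : Il C) (x y : pregerm C).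

Definition il_inv s : Il C := exist _ (pinv (set_val s))
  (mem_set (Il_inv (set_valP s))).
Definition il_comp s t : Il C := exist _ (pcomp (set_val s) (set_val t))
  (mem_set (Il_comp (set_valP s) (set_valP t))).
Definition il_id (e : J C) : Il C := exist _ (pid (set_val e))
  (mem_set (Il_pid (set_valP e))).

Lemma pregerm_eq x y : gel x = gel y -> gchi x = gchi y -> x = y.
Proof.
rewrite /gel /gchi => h1 h2; apply: val_inj; rewrite -!set_valE.
by case: (set_val x) (set_val y) h1 h2 => ? ? [? ?] /= -> ->.
Qed.

Lemma gchi_inj (chi psi : Omega C) : set_val chi = set_val psi -> chi = psi.
Proof. exact: val_inj. Qed.

Lemma actE x (e : J C) : set_val (act x) e =
  set_val (gchi x) (Jel (J_pre (set_valP (gel x)) (set_valP e))).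
Proof. by []. Qed.

Lemma pre_invP x : set_val (act x) (domJ (il_inv (gel x))) = true.
Proof.
rewrite -(gchiP x) actE.
apply: chi_ext; apply/seteqP; split => u [v suv].
  by exists v.
by exists v => //; exists u.
Qed.

Definition pre_inv x : pregerm C := mkpre (pre_invP x).

Lemma pre_mulP x y : gchi x = act y ->
  set_val (gchi y) (domJ (il_comp (gel x) (gel y))) = true.
Proof.
move=> xy; rewrite -(gchiP x) xy actE; apply: chi_ext; apply/seteqP; split => u.
  by move=> [w [v tuv svw]]; exists v => //; exists w.
by move=> [v tuv [w svw]]; exists w; exists v.
Qed.

(** The product of [(s, t.chi)] and [(t, chi)] is [(st, chi)]. *)
Definition pre_mul x y : pregerm C :=
  insubd x (il_comp (gel x) (gel y), gchi y).

Lemma pre_mulE x y (xy : gchi x = act y) : pre_mul x y = mkpre (pre_mulP xy).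
Proof.
apply: val_inj; rewrite /pre_mul val_insubd.
by rewrite mem_set //; exact: pre_mulP.
Qed.

Lemma pre_idP (chi : Omega C) (e : J C) :
  set_val chi e = true -> set_val chi (domJ (il_id e)) = true.
Proof.
move=> <-; apply: chi_ext; apply/seteqP; split => [u [v []]//|u eu].
by exists u.
Qed.

Definition unit_idem (chi : Omega C) : {e : J C | set_val chi e = true} :=
  let: conj (And3 h _ _) _ := set_valP chi in cid h.

Definition pre_id (chi : Omega C) : pregerm C :=
  mkpre (pre_idP (svalP (unit_idem chi))).

Lemma act_inv x : act (pre_inv x) = gchi x.
Proof.
apply: gchi_inj; apply/funext => e.
transitivity (set_val (gchi x) (meetJ (domJ (gel x)) e)).
  rewrite actE -[gchi (pre_inv x)]/(act x) actE.
  apply: chi_ext; apply/seteqP; split => u.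
    by move=> [v suv [w svw ew]]; rewrite (graph_inj suv svw);
      split => //; exists v.
  by move=> [[v suv] eu]; exists v => //; exists u.
by rewrite chi_meet ?gchiP //; exact: set_valP.
Qed.

Lemma act_mul x y : gchi x = act y -> act (pre_mul x y) = act x.
Proof.
move=> xy; apply: gchi_inj; apply/funext => e.
rewrite (pre_mulE xy) !actE -[gchi (mkpre _)]/(gchi y) xy actE.
apply: chi_ext.
apply/seteqP; split => u.
  by move=> [w [v tuv svw] ew]; exists v => //; exists w.
by move=> [v tuv [w svw ew]]; exists w => //; exists v.
Qed.

Lemma act_id (chi : Omega C) (e : J C) (h : set_val chi e = true) :
  act (mkpre (pre_idP h)) = chi.
Proof.
apply: gchi_inj; apply/funext => f.
transitivity (set_val chi (meetJ e f)).
  rewrite actE -[gchi _]/chi; apply: chi_ext; apply/seteqP; split => u.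
    by move=> [v [eu <-]].
  by move=> [eu fu]; exists u.
by rewrite chi_meet ?h //; exact: set_valP.
Qed.

Lemma gel_continuous : continuous (@gel C : _ -> discrete_topology (Il C)).
Proof.
move=> x; apply: (@continuous_comp _ _ _ set_val fst).
  exact: initial_continuous.
exact: cvg_fst.
Qed.

Lemma gchi_continuous : continuous (@gchi C).
Proof.
move=> x; apply: (@continuous_comp _ _ _ set_val snd).
  exact: initial_continuous.
exact: cvg_snd.
Qed.

Lemma gel_near x0 : nbhs x0 [set x | gel x = gel x0].
Proof.
exact: gel_continuous (discrete_set1 (gel x0 : discrete_topology (Il C))).
Qed.

Lemma gchi_near x0 (e : J C) :
  nbhs x0 [set x | set_val (gchi x) e = set_val (gchi x0) e].
Proof.
exact: gchi_continuous (open_nbhs_nbhs (conj (chi_open e _) erefl)).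
Qed.

Lemma act_continuous : continuous (@act C).
Proof.
apply: Omega_continuous => e x0 A /= /nbhs_singleton Ax0.
apply: filterS2 (gel_near x0)
  (gchi_near x0 (Jel (J_pre (set_valP (gel x0)) (set_valP e)))).
move=> x h1 h2; suff xx0 : set_val (act x) e = set_val (act x0) e.
  by rewrite /= xx0.
rewrite [RHS]actE -h2 actE; apply: chi_ext.
exact: (congr1 (fun s : Il C => ppre (set_val s) (set_val e)) h1).
Qed.

Lemma pre_inv_continuous : continuous pre_inv.
Proof.
apply: continuous_comp_initial => x0.
have h : (fun x => il_inv (gel x) : discrete_topology (Il C)) @ x0 -->
    (il_inv (gel x0) : discrete_topology (Il C)).
  move=> A /= /nbhs_singleton Ax0.
  by apply: filterS (gel_near x0) => x /= ->.
exact: (cvg_pair h (@act_continuous x0)).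
Qed.

Lemma open_slice (A : set (pregerm C)) s : open A ->
  open [set chi : Omega C | exists h, A (@mkpre C s chi h)].
Proof.
move=> [V oV <-].
pose k (chi : Omega C) : discrete_topology (Il C) * Omega C := (s, chi).
rewrite [X in open X](_ : _ =
  [set chi : Omega C | set_val chi (domJ s) = true] `&`
  k @^-1` V).
  apply: openI; first exact: chi_open.
  apply: (@open_comp _ _ k) oV => chi _.
  exact: (cvg_pair (@cst_continuous (Omega C) (discrete_topology (Il C)) s chi)
    (@cvg_id _ (nbhs chi))).
apply/seteqP; split => chi; first by move=> [h Vh]; split; [exact: h|].
by move=> [h Vh]; exists h.
Qed.

End pregerms.

Section germs.
Variables (C : lc_category) (B : germ_base C).
Implicit Types (x y : pregerm C).

Definition germ_rel x y : bool := `[< gchi x = gchi y /\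
  exists2 A, B (set_val (gchi x)) A &
    prestr (set_val (gel x)) A = prestr (set_val (gel y)) A >].

Lemma prestrP (s t : pbij C) A : prestr s A = prestr t A ->
  forall u v, A u -> s u v <-> t u v.
Proof.
move=> st u v Au; have e : prestr s A u v = prestr t A u v by rewrite st.
split => [suv|tuv].
  by have [] : prestr t A u v by rewrite -e.
by have [] : prestr s A u v by rewrite e.
Qed.

Lemma prestr_eq (s t : pbij C) A : (forall u v, A u -> s u v <-> t u v) ->
  prestr s A = prestr t A.
Proof. by move=> st; apply: pbijP => u v /=; split=> -[Au /st]; split; auto. Qed.

Lemma germ_refl : reflexive germ_rel.
Proof.
move=> x; apply/asboolP; split => //.
by exists (set_val (domJ (gel x))) => //; apply: gb_J; exact: gchiP.
Qed.

Lemma germ_sym : symmetric germ_rel.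
Proof.
suff h x y : germ_rel x y -> germ_rel y x by move=> x y; apply/idP/idP; exact: h.
move=> /asboolP[xy [A BA e]]; apply/asboolP; split=> //.
by exists A; rewrite -?xy.
Qed.

Lemma germ_trans : transitive germ_rel.
Proof.
move=> y x z /asboolP[xy [A BA e]] /asboolP[yz [D BD f]].
apply/asboolP; split; first by rewrite xy.
exists (A `&` D).
  by apply: gb_I; [exact: set_valP|exact: BA|rewrite xy; exact: BD].
apply: prestr_eq => u v [Au Du].
by rewrite (prestrP e) // (prestrP f).
Qed.

Canonical germ_equiv := EquivRel germ_rel germ_refl germ_sym germ_trans.

(** The quotient topology is the one for which the images of the sets
    [{s} * Omega(s^-1 s)] are open and homeomorphic to [Omega(s^-1 s)] through
    the source map, see [bisection_open] and [bisection_continuous]. *)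
Definition germ : Type := quotient_topology {eq_quot germ_equiv}.
HB.instance Definition _ := Topological.on germ.

Definition germ_of x : germ := \pi_({eq_quot germ_equiv}) x.

Definition germ_repr (g : germ) : pregerm C :=
  repr (g : {eq_quot germ_equiv}).

Lemma germ_reprK g : germ_of (germ_repr g) = g.
Proof. exact: reprK. Qed.

Lemma germ_ofP x y : germ_of x = germ_of y <-> germ_rel x y.
Proof. exact: (rwP (eqquotP _ _ _)). Qed.

Lemma germ_repr_rel x : germ_rel (germ_repr (germ_of x)) x.
Proof. by apply/germ_ofP; rewrite germ_reprK. Qed.

Lemma germ_ind (P : germ -> Prop) : (forall x, P (germ_of x)) -> forall g, P g.
Proof. by move=> h g; rewrite -[g]germ_reprK. Qed.

Lemma germ_act x y : germ_rel x y -> act x = act y.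
Proof.
suff h x' y' (e : J C) : germ_rel x' y' ->
    set_val (act x') e = true -> set_val (act y') e = true.
  move=> xy; apply: gchi_inj; apply/funext => e; apply/idP/idP; apply: h => //.
  by rewrite germ_sym.
move=> /asboolP[xy [A BA st]]; rewrite !actE -xy.
apply: (gb_ext (set_valP (gchi x')) BA) => u [[v suv ev] Au].
by exists v => //; apply/(prestrP st).
Qed.

Lemma germ_rel_inv x y : germ_rel x y -> germ_rel (pre_inv x) (pre_inv y).
Proof.
move=> xy; have exy := germ_act xy.
move/asboolP: xy => [xy [A BA st]]; apply/asboolP; split; first exact: exy.
exists (ppre (set_val (il_inv (gel x))) A).
  apply: gb_act; [exact: set_valP|exact: pre_invP|].
  by move: BA; rewrite -(act_inv x).
apply: prestr_eq => v u [w swv Aw]; split => [suv|tuv].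
  have wu : w = u by exact: (graph_fun swv suv).
  by rewrite wu in Aw; apply/(prestrP st).
have twv : set_val (gel y) w v by apply/(prestrP st).
have <- : w = u by exact: (@graph_inj _ (set_val (gel y)) _ _ _ twv tuv).
exact: swv.
Qed.

Lemma germ_rel_mul x x' y y' : germ_rel x x' -> germ_rel y y' ->
  gchi x = act y -> germ_rel (pre_mul x y) (pre_mul x' y').
Proof.
move=> xx' yy' xy; have e := germ_act yy'.
have xy' : gchi x' = act y' by rewrite -e -xy; have /asboolP[] := xx'.
rewrite (pre_mulE xy) (pre_mulE xy').
move: xx' yy' => /asboolP[_ [A BA ss]] /asboolP[yy' [D BD tt]].
apply/asboolP; split; first exact: yy'.
exists (ppre (set_val (gel y)) A `&` D).
  apply: gb_I; [exact: set_valP| |exact: BD].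
  by apply: gb_act; [exact: set_valP|exact: gchiP|rewrite xy in BA].
apply: prestr_eq => u w [[v0 tuv0 Av0] Du]; split => -[v tuv svw].
  exists v; first exact/(prestrP tt).
  by rewrite (graph_fun tuv0 tuv) in Av0; apply/(prestrP ss).
have tuv' : set_val (gel y) u v by apply/(prestrP tt).
by exists v => //; rewrite (graph_fun tuv0 tuv') in Av0; apply/(prestrP ss).
Qed.

Definition germ_src (g : germ) : Omega C := gchi (germ_repr g).
Definition germ_rng (g : germ) : Omega C := act (germ_repr g).
Definition germ_id (chi : Omega C) : germ := germ_of (pre_id chi).
Definition germ_inv (g : germ) : germ := germ_of (pre_inv (germ_repr g)).
Definition germ_mul (g h : germ) : germ :=
  germ_of (pre_mul (germ_repr g) (germ_repr h)).

Lemma germ_srcE x : germ_src (germ_of x) = gchi x.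
Proof. by have /asboolP[] := germ_repr_rel x. Qed.

Lemma germ_rngE x : germ_rng (germ_of x) = act x.
Proof. exact: germ_act (germ_repr_rel x). Qed.

Lemma germ_invE x : germ_inv (germ_of x) = germ_of (pre_inv x).
Proof. by apply/germ_ofP/germ_rel_inv/germ_repr_rel. Qed.

Lemma germ_mulE x y (xy : gchi x = act y) :
  germ_mul (germ_of x) (germ_of y) = germ_of (mkpre (pre_mulP xy)).
Proof.
rewrite -(pre_mulE xy); apply/germ_ofP; rewrite germ_sym.
by apply: germ_rel_mul => //; rewrite germ_sym; exact: germ_repr_rel.
Qed.

Lemma germ_idE (chi : Omega C) (e : J C) (h : set_val chi e = true) :
  germ_id chi = germ_of (mkpre (pre_idP h)).
Proof.
apply/germ_ofP/asboolP; split => //.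
set e' := sval (unit_idem chi); exists (set_val (meetJ e e')).
  apply: gb_J; rewrite chi_meet; last exact: set_valP.
  by apply/andP; split => //; exact: (svalP (unit_idem chi)).
by apply: prestr_eq => u v [eu e'u]; split => -[].
Qed.

Lemma germ_eq x y : gchi x = gchi y ->
  (forall u v, set_val (gel x) u v <-> set_val (gel y) u v) ->
  germ_of x = germ_of y.
Proof.
move=> xy st; congr germ_of; apply: pregerm_eq => //.
by apply: val_inj; apply: pbijP.
Qed.

Lemma germ_of_continuous : continuous germ_of.
Proof. exact: pi_continuous. Qed.

Lemma germ_of_open (U : set (pregerm C)) : open U -> open (germ_of @` U).
Proof.
move=> oU; rewrite /open/= /quotient_open openE => x [y Uy /germ_ofP].
move=> /asboolP[yx [A BA st]]; rewrite /interior.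
have h : nbhs (gchi x) ([set chi : Omega C | B (set_val chi) A] `&`
    [set chi : Omega C | exists h, U (@mkpre C (gel y) chi h)]).
  apply: open_nbhs_nbhs; split.
    by apply: openI; [exact: gb_open|exact: open_slice].
  rewrite -yx; split; first exact: BA.
  exists (gchiP y); suff -> : mkpre (gchiP y) = y by [].
  exact: pregerm_eq.
have h' := gchi_continuous h.
apply: filterS2 (gel_near x) h' => z /= zx [BzA [hz Uz]].
exists (mkpre hz) => //; apply/germ_ofP/asboolP; split => //.
by exists A => //; rewrite zx.
Qed.

Lemma germ_src_continuous : continuous germ_src.
Proof.
apply/quotient_continuous; rewrite (_ : _ \o _ = @gchi C); last first.
  by apply/funext => x; exact: germ_srcE.
exact: gchi_continuous.
Qed.

Lemma germ_rng_continuous : continuous germ_rng.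
Proof.
apply/quotient_continuous; rewrite (_ : _ \o _ = @act C); last first.
  by apply/funext => x; exact: germ_rngE.
exact: act_continuous.
Qed.

Lemma germ_inv_continuous : continuous germ_inv.
Proof.
apply/quotient_continuous; rewrite (_ : _ \o _ = germ_of \o @pre_inv C).
  move=> x; apply: continuous_comp; first exact: pre_inv_continuous.
  exact: germ_of_continuous.
by apply/funext => x; exact: germ_invE.
Qed.

(** The images of [{s} * U], for [U] open in [Omega(s^-1 s)], are open. *)
Lemma bisection_open (s : Il C) (U : set (Omega C)) : open U ->
  open [set g | exists chi (h : set_val chi (domJ s) = true),
    U chi /\ g = germ_of (mkpre h)].
Proof.
move=> oU; rewrite [X in open X](_ : _ = germ_of @`
    (@gel C @^-1` [set s] `&` @gchi C @^-1` U)); last first.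
  apply/seteqP; split => g.
    by move=> [chi [h [Uchi ->]]]; exists (mkpre h).
  move=> [x [xs Ux] <-]; exists (gchi x).
  by rewrite /= in xs; subst s; exists (gchiP x); split => //; apply: germ_eq.
apply: germ_of_open; apply: openI.
  by apply: (open_comp (f := @gel C : _ -> discrete_topology (Il C)));
    [move=> ? _; exact: gel_continuous|exact: discrete_open].
by apply: open_comp => // ? _; exact: gchi_continuous.
Qed.

(** [chi |-> [s, chi]] is continuous on [Omega(s^-1 s)]; it is inverse to the
    source map by [germ_srcE]. *)
Lemma bisection_continuous (s : Il C) (W : set germ) : open W ->
  open [set chi : Omega C | exists h : set_val chi (domJ s) = true,
    W (germ_of (mkpre h))].
Proof.
move=> oW; apply: (@open_slice C (germ_of @^-1` W)).
by apply: open_comp => // ? _; exact: germ_of_continuous.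
Qed.

Lemma germ_id_continuous : continuous germ_id.
Proof.
move=> chi W; rewrite nbhsE => -[V [oV Vchi] VW].
have [e che] := unit_idem chi.
have h : nbhs chi [set psi : Omega C | exists h : set_val psi (domJ (il_id e)) = true,
    V (germ_of (mkpre h))].
  apply: open_nbhs_nbhs; split; first exact: bisection_continuous.
  by exists (pre_idP che); rewrite -germ_idE.
apply: filterS h => psi [h Vh]; apply: VW.
have he : set_val psi e = true.
  rewrite -h; apply: chi_ext; apply/seteqP; split => [u eu|u [v []]//].
  by exists u.
by rewrite (germ_idE he) (Prop_irrelevance (pre_idP he) h).
Qed.

Lemma germ_mul_continuous :
  {within [set gh | germ_src gh.1 = germ_rng gh.2],
    continuous (fun gh : germ * germ => germ_mul gh.1 gh.2)}.
Proof.
apply/subspace_continuousP => -[g h] /=; elim/germ_ind: g => x.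
elim/germ_ind: h => y; rewrite germ_srcE germ_rngE => xy.
move=> W hW; have {hW} : nbhs (germ_mul (germ_of x) (germ_of y)) W by exact: hW.
rewrite (germ_mulE xy) nbhsE => -[V [oV Vxy] VW].
pose D := [set chi : Omega C | exists h : set_val chi (domJ (il_comp (gel x) (gel y)))
  = true, V (germ_of (mkpre h))].
have oD : open D by exact: bisection_continuous.
have nb (z : pregerm C) (U : set (Omega C)) : open U -> U (gchi z) ->
    nbhs (germ_of z) [set g | exists chi (h : set_val chi (domJ (gel z)) = true),
    U chi /\ g = germ_of (mkpre h)].
  move=> oU Uz; apply: open_nbhs_nbhs; split; first exact: bisection_open.
  by exists (gchi z), (gchiP z); split => //; apply: germ_eq.
exists ([set g | exists chi (h : set_val chi (domJ (gel x)) = true),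
    setT chi /\ g = germ_of (mkpre h)],
  [set g | exists chi (h : set_val chi (domJ (gel y)) = true),
    D chi /\ g = germ_of (mkpre h)]).
  split; apply: nb => //; first exact: openT.
  by exists (pre_mulP xy).
move=> [g h] /= [[chi [p [_ ->]]] [psi [q [[r Vr] ->]]]].
rewrite germ_srcE germ_rngE => zw; apply: VW.
suff : V (germ_mul (germ_of (mkpre p)) (germ_of (mkpre q))) by [].
rewrite (germ_mulE zw).
suff <- : mkpre r = mkpre (pre_mulP zw) by [].
exact: pregerm_eq.
Qed.

Program Definition germ_groupoid : topological_groupoid :=
  @TopologicalGroupoid germ (Omega C) germ_src germ_rng germ_id germ_inv germ_mul
  _ _ _ _ _ _ _ _ _ _ _ germ_src_continuous germ_rng_continuous
  germ_id_continuous germ_inv_continuous germ_mul_continuous.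
Next Obligation. by move=> chi; rewrite germ_srcE. Qed.
Next Obligation. by move=> chi; rewrite germ_rngE act_id. Qed.
Next Obligation.
by elim/germ_ind => x; rewrite germ_invE germ_srcE germ_rngE.
Qed.
Next Obligation.
by elim/germ_ind => x; rewrite germ_invE germ_srcE germ_rngE act_inv.
Qed.
Next Obligation.
elim/germ_ind => x; elim/germ_ind => y; rewrite germ_srcE germ_rngE => xy.
by rewrite (germ_mulE xy) !germ_srcE.
Qed.
Next Obligation.
elim/germ_ind => x; elim/germ_ind => y; rewrite germ_srcE germ_rngE => xy.
by rewrite (germ_mulE xy) !germ_rngE -(pre_mulE xy) act_mul.
Qed.
Next Obligation.
elim/germ_ind => x; elim/germ_ind => y; elim/germ_ind => z.
rewrite !germ_srcE !germ_rngE => xy yz.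
have xyz : gchi x = act (mkpre (pre_mulP yz)) by rewrite -pre_mulE act_mul.
have xyz' : gchi (mkpre (pre_mulP xy)) = act z by [].
rewrite (germ_mulE xy) (germ_mulE yz) (germ_mulE xyz) (germ_mulE xyz').
apply: germ_eq => // u v; split.
  by move=> [b [a ua ab] bv]; exists a => //; exists b.
by move=> [a ua [b ab bv]]; exists b => //; exists a.
Qed.
Next Obligation.
elim/germ_ind => x; rewrite germ_srcE (germ_idE (gchiP x)).
have h : gchi x = act (mkpre (pre_idP (gchiP x))) by rewrite act_id.
rewrite (germ_mulE h); apply: germ_eq => // u v; split.
  by move=> [w [_ ->]].
by move=> suv; exists u => //; split => //; exists v.
Qed.
Next Obligation.
elim/germ_ind => x; rewrite germ_rngE (germ_idE (pre_invP x)).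
have h : gchi (mkpre (pre_idP (pre_invP x))) = act x by [].
rewrite (germ_mulE h); apply: germ_eq => // u v; split.
  by move=> [w suw [_ <-]].
by move=> suv; exists v => //; split => //; exists u.
Qed.
Next Obligation.
elim/germ_ind => x; rewrite germ_invE germ_rngE (germ_idE (pre_invP x)).
have h : gchi x = act (pre_inv x) by rewrite act_inv.
rewrite (germ_mulE h); apply: germ_eq => // u v; split.
  move=> [w swu swv]; split; first by exists w.
  exact: (@graph_fun _ (set_val (gel x)) _ _ _ swu swv).
by move=> [[w swu] <-]; exists w.
Qed.
Next Obligation.
elim/germ_ind => x; rewrite germ_invE germ_srcE (germ_idE (gchiP x)).
have h : gchi (pre_inv x) = act x by [].
rewrite (germ_mulE h); apply: germ_eq => // u v; split.
  move=> [w swu swv]; split; first by exists w.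
  exact: (@graph_inj _ (set_val (gel x)) _ _ _ swu swv).
by move=> [[w swu] <-]; exists w.
Qed.

End germs.

Definition Il_ltimes (C : lc_category) : topological_groupoid :=
  germ_groupoid (J_base C).

Definition Il_ltimes_bar (C : lc_category) : topological_groupoid :=
  germ_groupoid (Jbar_base C).

Definition canonical_projection (C : lc_category) :
    Il_ltimes C -> Il_ltimes_bar C :=
  fun g => germ_of (Jbar_base C) (germ_repr g).

Lemma canonical_projectionE (C : lc_category) (x : pregerm C) :
  canonical_projection (germ_of (J_base C) x : Il_ltimes C) =
  germ_of (Jbar_base C) x.
Proof.
apply/germ_ofP/asboolP; have /asboolP[e [A BA st]] := germ_repr_rel (J_base C) x.
by split => //; exists A => //; exact: chi_atP.
Qed.

Lemma Il_ltimes_eqP (C : lc_category) (x y : pregerm C) :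
  germ_of (J_base C) x = germ_of (J_base C) y <->
  gchi x = gchi y /\ exists e : J C, set_val (gchi x) e = true /\
    prestr (set_val (gel x)) (set_val e) = prestr (set_val (gel y)) (set_val e).
Proof.
split=> [/germ_ofP/asboolP[xy [_ [e <- che] st]]|[xy [e [che st]]]].
  by split => //; exists e.
by apply/germ_ofP/asboolP; split => //; exists (set_val e) => //; exists e.
Qed.

Lemma Il_ltimes_bar_eqP (C : lc_category) (x y : pregerm C) :
  germ_of (Jbar_base C) x = germ_of (Jbar_base C) y <->
  gchi x = gchi y /\ exists2 eps, Jbar C eps /\ chi_bar (set_val (gchi x)) eps &
    prestr (set_val (gel x)) eps = prestr (set_val (gel y)) eps.
Proof.
split=> [/germ_ofP/asboolP[xy [eps ch st]]|[xy [eps [_ ch] st]]].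
  split => //; exists eps => //; split => //.
  by have [e [n [f [re _ _]]]] := ch; exists e, n, f.
by apply/germ_ofP/asboolP; split => //; exists eps.
Qed.

(* Main.v *)
(** The projection is always a continuous, open and surjective functor, so only
    injectivity is at stake.  Partial bijections in [Il] commute with right
    multiplication, so [s] and [t] agree on the ideal [uC] as soon as they agree
    at [u], and an [eps] in [Jbar] witnessing [s eps = t eps] can be traded for
    an ideal [uC] with [u] in [eps].  If [C] is finitely aligned, every element
    of [J] is a finite union of principal ideals, so some [uC] inside
    [dom s /\ dom t /\ e] has [chi (uC) = 1], where [eps = e \ (f_1 u ... u f_n)];
    then [u] is in [eps], as otherwise [uC] would lie in some [f_i].  In general,
    the characters [e |-> (u \in e)] belong to [Omega], and those with [u] in
    [eps] accumulate at [chi].  The germs of [s] and [t] at these characters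
    coincide, so the germs at [chi] cannot be separated by open sets. *)
From mathcomp Require Import all_boot all_classical topology.
Require Import Defs.

Set Implicit Arguments.
Unset Strict Implicit.
Unset Printing Implicit Defensive.

Local Open Scope classical_set_scope.

(** * Partial bijections in [Il] and right multiplication *)

Section equivariance.
Variable C : lc_category.
Implicit Types (s t : pbij C) (e : set C).

Definition equivariant s := forall x y z,
  s x y -> dom x = tgt z -> dom y = dom x /\ s (comp x z) (comp y z).

(** Associativity settles the generators. The induction carries the property for [s] and [pinv s]
    together, which makes it stable under inverses. *)
Lemma Il_equivariant s : Il C s -> equivariant s.
Proof.
move=> Is; suff [] : equivariant s /\ equivariant (pinv s) by [].
apply: (Is [set t | equivariant t /\ equivariant (pinv t)]); split.
  split=> [{Is}s t [Es Es'] [Et Et']|t [Et Et']]; last by split.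
  split=> x z w [y h1 h2] xw.
    have [yx h3] := Et _ _ _ h1 xw.
    have [|zy h4] := Es _ _ w h2; first by rewrite yx.
    by split; [rewrite zy yx|exists (comp y w)].
  have [yx h3] := Es' _ _ _ h2 xw.
  have [|zy h4] := Et' _ _ w h1; first by rewrite yx.
  by split; [rewrite zy yx|exists (comp y w)].
move=> _ [c _ <-]; split=> x y z.
  move=> [cx ->] xz; rewrite dom_comp //; split=> //; split.
    by rewrite tgt_comp.
  by rewrite compA.
move=> [cy ->]; rewrite dom_comp // => yz; split=> //; split.
  by rewrite tgt_comp.
by rewrite compA.
Qed.

Lemma rideal_refl (u : C) : rideal u u.
Proof. by exists (dom u); rewrite ?tgt_dom ?comp_dom. Qed.

Lemma pdom_lmulV (c : C) : pdom (pinv (lmul c)) = rideal c.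
Proof.
by apply/seteqP; split=> [x [y [cy ->]]|_ [y cy ->]]; exists y.
Qed.

Lemma pdom_lmul (c : C) : pdom (lmul c) = rideal (dom c).
Proof.
apply/seteqP; split=> x.
  by move=> [_ [cx _]]; exists x; rewrite ?dom_dom // cx tgt_compl.
move=> [z]; rewrite dom_dom => cz ->; rewrite cz tgt_compl.
by exists (comp c z).
Qed.

Lemma Il_lmul (c : C) : Il C (lmul c).
Proof. by move=> S [_ +]; apply; exists c. Qed.

Lemma J_rideal (u : C) : J C (rideal u).
Proof. by rewrite -pdom_lmulV; exact: J_dom (Il_inv (Il_lmul u)). Qed.

Lemma J_rideal_sub e u : J C e -> e u -> rideal u `<=` e.
Proof.
move=> [s Is <-] [v suv] _ [z uz ->].
by have [_ suzv] := Il_equivariant Is suv uz; exists (comp v z).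
Qed.

(** By equivariance both maps send [uz] to [vz]. *)
Lemma Il_prestr_rideal s t u v : Il C s -> Il C t -> s u v -> t u v ->
  prestr s (rideal u) = prestr t (rideal u).
Proof.
move=> Is It suv tuv; apply: prestr_eq => _ w [z uz ->].
have [_ h1] := Il_equivariant Is suv uz; have [_ h2] := Il_equivariant It tuv uz.
by split=> h; [rewrite (graph_fun h h1)|rewrite (graph_fun h h2)].
Qed.

End equivariance.

(** * Finite generation of the ideals in [J] *)

Section finitely_aligned.
Variable C : lc_category.
Implicit Types (s : pbij C) (A : set C).

Definition fg_ideal A :=
  exists F : set C, finite_set F /\ A = \bigcup_(c in F) rideal c.

Lemma fg_rideal c : fg_ideal (rideal c).
Proof. by exists [set c]; split; [exact: finite_set1|rewrite bigcup_set1]. Qed.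

Lemma fg_ideal0 : fg_ideal set0.
Proof. by exists set0; split; [exact: finite_set0|rewrite bigcup_set0]. Qed.

Lemma fg_bigcup (F : set C) (A : C -> set C) : finite_set F ->
  (forall c, F c -> fg_ideal (A c)) -> fg_ideal (\bigcup_(c in F) A c).
Proof.
move=> finF fgA.
have /choice[G GP] c : exists G, F c ->
    finite_set G /\ A c = \bigcup_(d in G) rideal d.
  have [/fgA[G ?]|nFc] := pselect (F c); first by exists G.
  by exists set0.
exists (\bigcup_(c in F) G c); split.
  by apply: bigcup_finite => // c /GP[].
rewrite bigcup_bigcup; apply/seteqP; split=> x [c Fc].
  by rewrite (GP c Fc).2; exists c.
by move=> h; exists c => //; rewrite (GP c Fc).2.
Qed.

(** Finite generation of the domain alone is not visibly stable under products: the domain of [st]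
    is the preimage under [t] of that of [s], whence the second clause. *)
Definition preserves_fg s :=
  fg_ideal (pdom s) /\ forall A, fg_ideal A -> fg_ideal (ppre s A).

Lemma preserves_fg_comp s t :
  preserves_fg s -> preserves_fg t -> preserves_fg (pcomp s t).
Proof.
move=> [ds ps] [dt pt]; split.
  rewrite (_ : pdom _ = ppre t (pdom s)); first exact: pt.
  apply/seteqP; split=> x; first by move=> [z [y txy syz]]; exists y => //; exists z.
  by move=> [y txy [z syz]]; exists z, y.
move=> A fgA; rewrite (_ : ppre _ _ = ppre t (ppre s A)); first exact/pt/ps.
apply/seteqP; split=> x.
  by move=> [z [y txy syz] Az]; exists y => //; exists z.
by move=> [y txy [z syz Az]]; exists z => //; exists y.
Qed.

Lemma fg_ppre s :
  (forall a, fg_ideal (ppre s (rideal a))) ->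
  forall A, fg_ideal A -> fg_ideal (ppre s A).
Proof.
move=> h _ [F [finF ->]].
rewrite (_ : ppre _ _ = \bigcup_(c in F) ppre s (rideal c)).
  by apply: fg_bigcup => // c _; exact: h.
apply/seteqP; split=> x.
  by move=> [y sxy [c Fc cy]]; exists c => //; exists y.
by move=> [c Fc [y sxy cy]]; exists y => //; exists c.
Qed.

(** The preimage of [aC] is [caC] if [ca] is defined, and empty otherwise. *)
Lemma preserves_fg_lmulV (c : C) : preserves_fg (pinv (lmul c)).
Proof.
split; first by rewrite pdom_lmulV; exact: fg_rideal.
apply: fg_ppre => a; have [ca|nca] := pselect (dom c = tgt a).
  rewrite (_ : ppre _ _ = rideal (comp c a)); first exact: fg_rideal.
  apply/seteqP; split=> x.
    by move=> [_ [_ ->] [z az ->]]; exists z; rewrite ?dom_comp // compA.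
  move=> [z]; rewrite dom_comp // => az ->; exists (comp a z); last by exists z.
  by split; rewrite ?tgt_comp // compA.
rewrite (_ : ppre _ _ = set0); first exact: fg_ideal0.
apply/seteqP; split=> // x [y [cy _] [z az yE]].
by apply: nca; rewrite cy yE tgt_comp.
Qed.

(** Finite alignment writes the intersection of [cC] and [aC] as a finite union of ideals [bC]. Each
    [b] factors as [c (g b)], and cancelling [c] shows that the [g b] generate the preimage of
    [aC]. *)
Lemma preserves_fg_lmul (c : C) : finitely_aligned C -> preserves_fg (lmul c).
Proof.
move=> fa; split; first by rewrite pdom_lmul; exact: fg_rideal.
apply: fg_ppre => a; have [F [finF FE]] := fa c a.
have /choice[g gP] b : exists b', F b -> dom c = tgt b' /\ b = comp c b'.
  have [Fb|nFb] := pselect (F b); last by exists b.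
  have [[b' cb' bE] _] : (rideal c `&` rideal a) b.
    by rewrite FE; exists b => //; exact: rideal_refl.
  by exists b'.
rewrite (_ : ppre _ _ = \bigcup_(b in F) rideal (g b)).
  by apply: fg_bigcup => // b _; exact: fg_rideal.
apply/seteqP; split=> x.
  move=> [_ [cx ->] ax].
  have : (rideal c `&` rideal a) (comp c x) by split=> //; exists x.
  rewrite FE => -[b Fb [z bz e]]; have [cg bE] := gP b Fb.
  have gz : dom (g b) = tgt z by rewrite -bz [in RHS]bE dom_comp.
  exists b => //; exists z => //.
  apply: (lc_cancel cx); first by rewrite tgt_comp.
  by rewrite e compA // -bE.
move=> [b Fb [z gz ->]]; have [cg bE] := gP b Fb.
have bz : dom b = tgt z by rewrite [in LHS]bE dom_comp.
have [_ abz] : (rideal c `&` rideal a) (comp b z).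
  by rewrite FE; exists b => //; exists z.
exists (comp b z) => //; split; first by rewrite tgt_comp.
by rewrite compA // -bE.
Qed.

Lemma J_fg (e : set C) : finitely_aligned C -> J C e -> fg_ideal e.
Proof.
move=> fa [s Is <-].
suff [[]] : preserves_fg s /\ preserves_fg (pinv s) by [].
apply: (Is [set t | preserves_fg t /\ preserves_fg (pinv t)]); split.
  split=> [{Is}s t [ps ps'] [pt pt']|t [pt pt']].
    split; first exact: preserves_fg_comp.
    rewrite (_ : pinv _ = pcomp (pinv t) (pinv s)).
      exact: preserves_fg_comp.
    by apply: pbijP => x y; split=> -[z]; exists z.
  by split=> //; rewrite (_ : pinv _ = t) //; exact: pbijP.
move=> _ [c _ <-]; split; first exact: preserves_fg_lmul.
exact: preserves_fg_lmulV.
Qed.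

Lemma Omega_rideal (chi : Jmap C) (e : J C) : finitely_aligned C ->
  Omega C chi -> chi e = true ->
  exists2 u, set_val e u & chi (Jel (J_rideal u)) = true.
Proof.
move=> fa Ochi che; have [F [finF eF]] : fg_ideal (set_val e) := J_fg fa (set_valP e).
(* [{classic C}] gives the morphisms a classical equality test, so that [F] can be listed and
   indexed by an ordinal as [Omega] requires. *)
have /finite_seqP[r Fr] : finite_set (F : set {classic C}) by [].
have Fi (i : 'I_(size r)) : F (tnth (in_tuple r) i).
  by rewrite Fr /=; exact: mem_tnth.
pose f (i : 'I_(size r)) := Jel (J_rideal (tnth (in_tuple r) i : C)).
have [|i chi1] := Ochi.2 e _ f _ che.
  rewrite eF; apply/seteqP; split=> x; last first.
    by move=> [i _ xi]; exists (tnth (in_tuple r) i).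
  move=> [c]; rewrite Fr /= => cr cx.
  have /tnthP[i ci] : (c : {classic C}) \in in_tuple r by [].
  by exists i => //; rewrite /f -ci.
by exists (tnth (in_tuple r) i) => //; rewrite eF; exists (tnth (in_tuple r) i);
  [exact: Fi|exact: rideal_refl].
Qed.

End finitely_aligned.

(** * Characters given by points *)

Section point_characters.
Variable C : lc_category.

Definition pchar (u : C) : Jmap C := fun e : J C => `[< set_val e u >].

Lemma pcharP u (e : J C) : pchar u e = true <-> set_val e u.
Proof. by split=> [/asboolP|/asboolP]. Qed.

(** A point of a union lies in one of its members; the ideal [uC] shows that the character is
    non-zero. *)
Lemma pchar_Omega u : Omega C (pchar u).
Proof.
split; first split.
- by exists (Jel (J_rideal u)); apply/pcharP; exact: rideal_refl.
- move=> e f g gE; apply/idP/andP => [/pcharP|[/pcharP eu /pcharP fu]].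
    by rewrite gE => -[eu fu]; split; apply/pcharP.
  by apply/pcharP; rewrite gE.
- by move=> e e0; apply/negP => /pcharP; rewrite e0.
- move=> e n f eE /pcharP; rewrite eE => -[i _ fu].
  by exists i; apply/pcharP.
Qed.

Definition pcharO u : Omega C := exist _ (pchar u) (mem_set (pchar_Omega u)).

Lemma chi_bar_setD (chi : Jmap C) (e f : J C) : Omega C chi ->
  chi e = true -> chi f = false -> chi_bar chi (set_val e `\` set_val f).
Proof.
(* A representation in [Jbar] only removes subsets of [e], so [f] is replaced by its intersection
   with [e]. *)
move=> Ochi che chf; exists e, 1, (fun=> meetJ e f); split=> //; last first.
  by move=> _; rewrite chi_meet // chf andbF.
split=> [_ x []//|]; apply/seteqP; split=> x [ex h]; split=> //.
  by move=> [_ _ [_ fx]].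
by move=> fx; apply: h; exists ord0.
Qed.

Lemma chi_bar_neq0 (chi : Jmap C) eps : Omega C chi -> chi_bar chi eps ->
  eps !=set0.
Proof.
move=> Ochi ch; apply/set0P/eqP => eps0; have [[[e che] _ _] _] := Ochi.
(* If [eps] were empty, the family with no members would do as a cover. *)
have [|[]//] := @chi_bar_cover _ chi eps e 0 (fun=> e) Ochi ch che.
by rewrite eps0 setI0.
Qed.

(** The sets of point characters over the [eps] with [chi eps = 1] form a filter base that converges
    pointwise to [chi]. *)
Lemma nbhs_pchar (chi : Omega C) (W : set (Omega C)) : nbhs chi W ->
  exists2 eps, chi_bar (set_val chi) eps & forall u, eps u -> W (pcharO u).
Proof.
have Ochi := set_valP chi.
rewrite nbhsE => -[_ [[V oV <-] Vchi] VW].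
pose F := filter_from [set eps | chi_bar (set_val chi) eps]
  (fun eps => pchar @` eps).
have FF : Filter F.
  apply: filter_from_filter.
    by have [[[e che] _ _] _] := Ochi; exists (set_val e); exact: chi_bar_J.
  move=> A B hA hB; exists (A `&` B); first exact: chi_bar_I.
  by move=> _ [u [Au Bu] <-]; split; exists u.
have Fchi : F --> (set_val chi : Jmap C).
  apply/cvg_sup => e A [_ [[B oB <-] Bchi BA]].
  have Fe : F [set psi | psi e = set_val chi e].
    (* The coordinate [e] is constant over [eps = e] when [chi e = 1], and over [e0] minus [e], with
       [chi e0 = 1], when [chi e = 0]. *)
    case che : (set_val chi e).
      exists (set_val e); first exact: chi_bar_J.
      by move=> _ [u eu <-]; apply/pcharP.
    have [[[e0 che0] _ _] _] := Ochi.
    exists (set_val e0 `\` set_val e); first exact: chi_bar_setD.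
    by move=> _ [u [_ neu] <-]; apply/negP => /pcharP.
  by apply: filterS Fe => psi psie; apply: BA; rewrite /= psie.
have [eps ch epsV] := Fchi V (open_nbhs_nbhs (conj oV Vchi)).
by exists eps => // u epsu; apply: VW; apply: epsV; exists u.
Qed.

End point_characters.

(** * Injectivity of the projection in each case *)

Section injectivity.
Variable C : lc_category.
Implicit Types x y : pregerm C.

Lemma germ_of_rideal x y u v : gchi x = gchi y ->
  set_val (gel x) u v -> set_val (gel y) u v ->
  set_val (gchi x) (Jel (J_rideal u)) = true ->
  germ_of (J_base C) x = germ_of (J_base C) y.
Proof.
move=> xy xuv yuv chu; apply/Il_ltimes_eqP; split=> //.
exists (Jel (J_rideal u)); split=> //.
exact: (Il_prestr_rideal (set_valP (gel x)) (set_valP (gel y)) xuv yuv).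
Qed.

Lemma germ_inj_finitely_aligned x y : finitely_aligned C ->
  germ_of (Jbar_base C) x = germ_of (Jbar_base C) y ->
  germ_of (J_base C) x = germ_of (J_base C) y.
Proof.
move=> fa /Il_ltimes_bar_eqP[xy [eps [_ [e [n [f [[_ epsE] che chf]]]]] st]].
have Ochi := set_valP (gchi x).
(* A point [u] of [D] has an image [v] under [gel x]; [st] transfers it to [gel y] once [u] is known
   to avoid every [f i]. *)
pose D := meetJ (domJ (gel x)) e.
have [|u [[v xuv] eu] chu] := Omega_rideal (e := D) fa Ochi.
  by rewrite chi_meet //; apply/andP; split => //; exact: gchiP.
apply: (germ_of_rideal xy xuv) => //; apply/(prestrP st) => //.
rewrite epsE; split=> // -[i _ fu].
have := chf i; rewrite (chi_at_ext (A := rideal u) (e := Jel (J_rideal u))) //.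
  by exists (Jel (J_rideal u)).
by move=> w [uw _]; exact: J_rideal_sub (set_valP (f i)) fu _ uw.
Qed.

Lemma germ_inj_hausdorff x y : hausdorff_space (Il_ltimes C) ->
  germ_of (Jbar_base C) x = germ_of (Jbar_base C) y ->
  germ_of (J_base C) x = germ_of (J_base C) y.
Proof.
move=> hd /Il_ltimes_bar_eqP[xy [eps [_ cheps] st]].
have Ochi := set_valP (gchi x).
(* Neighbourhoods of a germ are pulled back to [Omega] along its bisection. *)
have near_germ (z : pregerm C) (A : set (germ (J_base C))) :
    nbhs (germ_of (J_base C) z) A ->
    nbhs (gchi z) [set chi | exists h : set_val chi (domJ (gel z)) = true,
      A (germ_of (J_base C) (mkpre h))].
  rewrite nbhsE => -[V [oV Vz] VA].
  apply: filterS (open_nbhs_nbhs (conj (bisection_continuous (gel z) oV) _)).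
    by move=> chi [h Vh]; exists h; exact: VA.
  exists (gchiP z).
  by rewrite (_ : mkpre _ = z) //; exact: pregerm_eq.
(* [hausdorff_space] is phrased with cluster points: it remains to show that [A] and [B] meet. *)
apply: (hd (germ_of (J_base C) x) (germ_of (J_base C) y)) => A B nA nB.
have nB' := near_germ y B nB; rewrite -xy in nB'.
have [eps' cheps' epsAB] := nbhs_pchar (filterI (near_germ x A nA) nB').
have [u [epsu eps'u]] := chi_bar_neq0 Ochi (chi_bar_I Ochi cheps cheps').
have [[h Ah] [k Bk]] := epsAB u eps'u.
exists (germ_of (J_base C) (mkpre h)); split=> //.
(* At the character of [u], [h] says that [u] is in the domain of [gel x], and [u] in [eps] makes
   [gel y] take the same value there. *)
have /pcharP[v xuv] := h.
rewrite (@germ_of_rideal (mkpre h) (mkpre k) u v) //.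
  exact/(prestrP st).
by apply/pcharP; exact: rideal_refl.
Qed.

End injectivity.

(** * From injectivity to an isomorphism *)

Lemma canonical_projection_iso (C : lc_category) :
  (forall x y : pregerm C, germ_of (Jbar_base C) x = germ_of (Jbar_base C) y ->
    germ_of (J_base C) x = germ_of (J_base C) y) ->
  topological_groupoid_iso (@canonical_projection C).
Proof.
move=> inj; have pE := @canonical_projectionE C; split.
(* The inverse takes the finer germ of a chosen representative; [inj] makes the choice
   immaterial. *)
- exists (fun g : germ (Jbar_base C) => germ_of (J_base C) (germ_repr g)).
    move=> g; rewrite -{2}(germ_reprK g); apply: inj.
    by rewrite germ_reprK.
  by move=> g; rewrite pE germ_reprK.
- apply/quotient_continuous.
  rewrite (_ : _ \o _ = germ_of (Jbar_base C)); first exact: germ_of_continuous.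
  by apply/funext => x; exact: pE.
- move=> U oU.
  (* Openness is inherited from the quotient map of pregerms onto the coarser germs. *)
  rewrite (_ : _ @` U =
    germ_of (Jbar_base C) @` (germ_of (J_base C) @^-1` U)).
    apply: germ_of_open; apply: open_comp => // x _.
    exact: germ_of_continuous.
  apply/seteqP; split=> g [].
    by elim/germ_ind => x Ux <-; exists x => //; rewrite pE.
  by move=> x Ux <-; exists (germ_of (J_base C) x) => //; rewrite pE.
- elim/germ_ind => x; elim/germ_ind => y; rewrite !pE /=.
  by rewrite !germ_srcE !germ_rngE.
- elim/germ_ind => x; elim/germ_ind => y /=; rewrite germ_srcE germ_rngE => xy.
  by rewrite (germ_mulE (J_base C) xy) !pE (germ_mulE (Jbar_base C) xy).
Qed.

Theorem lemma3p2 (C : lc_category) :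
  finitely_aligned C \/ hausdorff_space (Il_ltimes C) ->
  topological_groupoid_iso (@canonical_projection C).
Proof.
move=> h; apply: canonical_projection_iso => x y; case: h => h.
  exact: germ_inj_finitely_aligned.
exact: germ_inj_hausdorff.
Qed.
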